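(* Let $\mathcal{J}$ be a (Hermitian, non-decomposable) Jacobi matrix, let $\{\hat P_n\}_{n=0}^{\infty}$ be the family of orthonormal polynomials determined by $\mathcal{J}$, and let $\mathcal{A}\in\mathbb{C}^{\infty,\infty}$. Then $$\mathcal{J}\mathcal{A}=\mathcal{A}\mathcal{J}\quad\Longleftrightarrow\quad\exists\,\{\alpha_k\}_{k=0}^{\infty}\subset\mathbb{C},\quad\mathcal{A}=\sum_{k=0}^{\infty}\alpha_k\,\hat P_k(\mathcal{J}).$$ As a consequence, if $\mathcal{J}\mathcal{A}=\mathcal{A}\mathcal{J}$, then $\mathcal{A}=\mathcal{A}^{T}$.
   Context: $\mathbb{C}^{\infty,\infty}$ is the space of semi-infinite complex matrices indexed by $\mathbb{N}_0\times\mathbb{N}_0$, $\mathbb{N}_0=\{0,1,2,\dots\}$. A Jacobi matrix $\mathcal{J}$ is a semi-infinite tridiagonal Hermitian matrix with $\mathcal{J}_{n,n}=b_n\in\mathbb{R}$ and $\mathcal{J}_{n,n+1}=\mathcal{J}_{n+1,n}=a_n\in\mathbb{R}$; non-decomposable means $a_n\neq0$ for all $n\in\mathbb{N}_0$. Since $\mathcal{J}$ is banded, the formal matrix products $\mathcal{J}\mathcal{A}$, $\mathcal{A}\mathcal{J}$ and the polynomials of $\mathcal{J}$ are well defined. The polynomials $\hat P_n$ determined by $\mathcal{J}$ are given by $a_{n-1}\hat P_{n-1}(x)+(b_n-x)\hat P_n(x)+a_n\hat P_{n+1}(x)=0$, $n\in\mathbb{N}_0$, with $\hat P_{-1}(x)=0$,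 $\hat P_0(x)=1$ (and $a_{-1}:=0$). The infinite sum $\sum_{k}\alpha_k\hat P_k(\mathcal{J})$ is understood entrywise; for each fixed entry $(m,n)$ only finitely many terms are nonzero (only those with $|m-n|\le k\le m+n$ can contribute). *)

(* Defs.v *)
From HB Require Import structures.
From mathcomp Require Import all_boot all_order all_algebra.
From mathcomp Require Import complex.
From mathcomp Require Import all_classical reals.
Set Implicit Arguments.
Unset Strict Implicit.
Unset Printing Implicit Defensive.
Import Order.TTheory GRing.Theory Num.Theory.
Local Open Scope complex_scope.
Local Open Scope classical_set_scope.
Local Open Scope ring_scope.

Definition smatrix (C : Type) : Type := nat -> nat -> C.

Section SemiInfiniteMatrices.
Variable C : comNzRingType.
Implicit Types (M N J : smatrix C) (p : {poly C}) (F : nat -> smatrix C).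

Definition smx_one : smatrix C := fun m n => (m == n)%:R.

(* The formal product.  The entry sum is finite whenever M has finitely many
   nonzero entries in each row or N has finitely many in each column; this is
   the case in all products below, where one factor is tridiagonal.  (The
   library's finitely supported sum is 0 when the support is infinite.) *)
Definition smx_mul M N : smatrix C :=
  fun m n => \sum_(k \in [set: nat]) M m k * N k n.

Definition smx_exp J (i : nat) : smatrix C := iter i (smx_mul J) smx_one.

Definition smx_horner p J : smatrix C :=
  fun m n => \sum_(i < size p) p`_i * smx_exp J i m n.

Definition smx_scale (c : C) M : smatrix C := fun m n => c * M m n.

Definition smx_tr M : smatrix C := fun m n => M n m.

(* M is the entrywise sum of the family F, each entry receiving only finitely
   many nonzero contributions.  The finiteness clause rules out the default
   value of the finitely supported sum. *)
Definition smx_is_sum F M : Prop :=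
  forall m n, finite_set [set k | F k m n != 0] /\
              M m n = \sum_(k \in [set: nat]) F k m n.

End SemiInfiniteMatrices.

Section Jacobi.
Variable R : realType.
Implicit Types a b : nat -> R.

Definition jacobi a b : smatrix R[i] := fun m n =>
  if m == n then (b n)%:C
  else if n == m.+1 then (a m)%:C
  else if m == n.+1 then (a n)%:C
  else 0.

(* The pair (P_n, P_{n+1}), from the three-term recurrence solved for its term
   of highest index; meaningful when no a n vanishes. *)
Fixpoint ortho_pair a b (n : nat) : {poly R[i]} * {poly R[i]} :=
  match n with
  | 0 => (1, (a 0%N)%:C^-1 *: ('X - (b 0%N)%:C%:P))
  | n'.+1 =>
    let: (p, q) := ortho_pair a b n' in
    (q, (a n'.+1)%:C^-1 *: (('X - (b n'.+1)%:C%:P) * q - (a n')%:C *: p))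
  end.

Definition ortho_poly a b (n : nat) : {poly R[i]} := (ortho_pair a b n).1.

Lemma ortho_poly0 a b : ortho_poly a b 0%N = 1.
Proof. by []. Qed.

Lemma complexC_scaleVK (c : R) (p : {poly R[i]}) :
  c != 0 -> c%:C *: (c%:C^-1 *: p) = p.
Proof.
by move=> c0; rewrite scalerA divff ?scale1r // (inj_eq (@complexI R)).
Qed.

Lemma ortho_poly_rec0 a b : a 0%N != 0 ->
  ((b 0%N)%:C%:P - 'X) * ortho_poly a b 0%N + (a 0%N)%:C *: ortho_poly a b 1%N = 0.
Proof.
move=> a0; rewrite /ortho_poly /= complexC_scaleVK // mulr1.
by rewrite addrA subrK subrr.
Qed.

Lemma ortho_poly_recS a b n : a n.+1 != 0 ->
  (a n)%:C *: ortho_poly a b n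
  + ((b n.+1)%:C%:P - 'X) * ortho_poly a b n.+1
  + (a n.+1)%:C *: ortho_poly a b n.+2 = 0.
Proof.
move=> an; rewrite /ortho_poly /=; case: (ortho_pair a b n) => p q /=.
by rewrite complexC_scaleVK // -(opprB 'X) mulNr addrA subrK subrr.
Qed.

End Jacobi.

(* Main.v *)
Require Import Defs.
From HB Require Import structures.
From mathcomp Require Import all_boot all_order all_algebra.
From mathcomp Require Import complex ring.
From mathcomp Require Import all_classical reals.
Set Implicit Arguments.
Unset Strict Implicit.
Unset Printing Implicit Defensive.
Import Order.TTheory GRing.Theory Num.Theory.
Local Open Scope complex_scope.
Local Open Scope ring_scope.

(** A matrix X commutes with J exactly when the Jacobi operator gives the same
    result on the columns and on the rows of X.  At (m, n) this relation can be
    solved for X (m+1) n, because a m is nonzero, so that the first row of X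
    determines X; quantitatively, X m n depends only on the entries X 0 j with
    j <= m + n ([commuting_local]).

    Write Q k for the matrix P_k(J).  It commutes with J, and its first row is
    the k-th unit vector ([horner_ortho_row0]): the array of the entries Q k 0 j,
    indexed by k and j, itself satisfies the commutation relation, as the
    three-term recurrence of the P_k is the action of J on the index k; its row
    k = 0 is that of the identity matrix, which also commutes with J, hence it is
    the identity matrix.  By locality, Q k m n = 0 for k > m + n.

    If A commutes with J, set alpha k = A 0 k.  The matrix A and the partial sum
    of the alpha k Q k over k <= m + n commute with J and have the same first
    row up to the index m + n, so they agree at (m, n).  Conversely, the entries
    of A that occur in the commutation relation at (m, n) agree with those of
    one partial sum of the series, and this partial sum commutes with J.
    Finally, powers of J are symmetric, hence so is every Q k, and with them
    A. *)

(** * Three-term operators and matrices commuting with them *)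

Section ThreeTerm.
Variable C : comNzRingType.
Variables al be : nat -> C.
Implicit Types (u v : nat -> C) (X : smatrix C).

(** The action of a tridiagonal symmetric matrix with diagonal be and
    off-diagonal al on a sequence u: applied to the columns of X it gives J X,
    to the rows X J.  Unlike the formal product, it involves no infinite sum. *)
Definition three_term u (n : nat) : C :=
  (if n is n'.+1 then al n' * u n' else 0) + be n * u n + al n * u n.+1.

Lemma eq_three_term u v n : (forall k, (k <= n.+1)%N -> u k = v k) ->
  three_term u n = three_term v n.
Proof.
move=> uv; rewrite /three_term (uv n) // (uv n.+1) //.
by case: n uv => // n uv; rewrite (uv n) // -addn2 leq_addr.
Qed.

Lemma three_term_last u n : (forall k, (k <= n)%N -> u k = 0) ->
  three_term u n = al n * u n.+1.
Proof.
move=> u0; rewrite /three_term (u0 n) // mulr0 addr0.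
by case: n u0 => [|n] u0; rewrite ?(u0 n) // ?mulr0 add0r.
Qed.

Lemma three_term_sum (I : Type) (r : seq I) (c : I -> C) (U : I -> nat -> C) n :
  three_term (fun k => \sum_(i <- r) c i * U i k) n =
  \sum_(i <- r) c i * three_term (U i) n.
Proof.
rewrite /three_term.
under [RHS]eq_bigr do rewrite !mulrDr !(mulrCA (c _)).
rewrite !big_split /= !mulr_sumr; congr (_ + _ + _).
case: n => [|n]; first by rewrite big1 // => i _; rewrite mulr0.
by rewrite mulr_sumr; apply: eq_bigr => i _; rewrite mulrCA.
Qed.

Definition commuting X : Prop :=
  forall m n, three_term (X^~ n) m = three_term (X m) n.

Lemma commuting_sum (I : Type) (r : seq I) (c : I -> C) (F : I -> smatrix C) :
  (forall i, commuting (F i)) ->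
  commuting (fun m n => \sum_(i <- r) c i * F i m n).
Proof.
move=> cF m n; rewrite !three_term_sum.
by apply: eq_bigr => i _; rewrite cF.
Qed.

Lemma smx_one_sym m n : smx_one C m n = smx_one C n m.
Proof. by rewrite /smx_one eq_sym. Qed.

Lemma commuting_one : commuting (@smx_one C).
Proof.
(* The identity being symmetric, entries above the diagonal suffice. *)
have above m n : (m < n)%N ->
    three_term ((@smx_one C)^~ n) m = three_term (smx_one C m) n.
  move=> lt_mn; rewrite three_term_last => [|k le_km]; last first.
    by rewrite /smx_one ltn_eqF // (leq_ltn_trans le_km).
  case: n lt_mn => // n lt_mn; rewrite /three_term /smx_one eqSS.
  rewrite (ltn_eqF lt_mn) (ltn_eqF (leqW lt_mn)) !mulr0 !addr0.
  by case: eqVneq => [->|]; rewrite ?mulr0.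
have flip m n : three_term ((@smx_one C)^~ n) m = three_term (smx_one C n) m.
  by apply: eq_three_term => k _; rewrite smx_one_sym.
move=> m n; have [/above //|/above lt_nm|->] := ltngtP m n; last exact: flip.
by rewrite flip -lt_nm flip.
Qed.

(** The actions of J on the row index and on the column index commute with each
    other, which amounts to associativity of the product J X J. *)
Lemma commuting_three_term X :
  commuting X -> commuting (fun m n => three_term (X^~ n) m).
Proof.
move=> cX m n.
rewrite (eq_three_term (v := fun k => three_term (X k) n)) => [|k _ //].
by rewrite /three_term; case: m n => [|m] [|n]; ring.
Qed.

End ThreeTerm.

Section Locality.
Variable C : idomainType.
Variables al be : nat -> C.
Hypothesis al_neq0 : forall n, al n != 0.

(** The commutation relation at (m, n), solved for the entry (m+1, n), involves
    only rows m - 1 and m, and there only columns up to n + 1: each step down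
    widens the window of columns by one. *)
Lemma commuting_local (X Y : smatrix C) m n :
  commuting al be X -> commuting al be Y ->
  (forall j, (j <= m + n)%N -> X 0%N j = Y 0%N j) -> X m n = Y m n.
Proof.
move=> cX cY; elim/ltn_ind: m n => -[|m] IHm n XY0; first exact: XY0.
have XY i j : (i <= m)%N -> (j <= n.+1)%N -> X i j = Y i j.
  move=> le_im le_jn; apply: IHm => [|k le_k]; first by rewrite ltnS.
  by apply: XY0; apply: leq_trans le_k _; rewrite addSnnS leq_add.
have: three_term al be (X^~ n) m = three_term al be (Y^~ n) m.
  by rewrite cX cY; apply: eq_three_term => j; apply: XY.
rewrite /three_term (XY m) //.
have -> : (if m is m'.+1 then al m' * X m' n else 0) =
          (if m is m'.+1 then al m' * Y m' n else 0).
  by case: m XY {IHm XY0} => // m XY; rewrite XY.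
by move/addrI/(mulfI (al_neq0 m)).
Qed.

End Locality.

(** * Polynomials of a semi-infinite matrix *)

Section Horner.
Variable C : comNzRingType.
Implicit Types (p q : {poly C}) (J : smatrix C).

Lemma smx_horner_widen N p J m n : (size p <= N)%N ->
  smx_horner p J m n = \sum_(i < N) p`_i * smx_exp J i m n.
Proof.
move=> le_pN; rewrite /smx_horner.
rewrite (big_ord_widen _ (fun i => p`_i * smx_exp J i m n) le_pN) big_mkcond /=.
apply: eq_bigr => i _; case: ltnP => // le_pi.
by rewrite nth_default // mul0r.
Qed.

Lemma smx_hornerD p q J m n :
  smx_horner (p + q) J m n = smx_horner p J m n + smx_horner q J m n.
Proof.
rewrite !(@smx_horner_widen (maxn (size p) (size q))) ?size_polyD ?leq_maxl //.
  by rewrite -big_split; apply: eq_bigr => i _; rewrite coefD mulrDl.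
exact: leq_maxr.
Qed.

Lemma smx_hornerZ c p J m n :
  smx_horner (c *: p) J m n = c * smx_horner p J m n.
Proof.
rewrite !(@smx_horner_widen (size p)) ?size_scale_leq // mulr_sumr.
by apply: eq_bigr => i _; rewrite coefZ mulrA.
Qed.

Lemma smx_horner0 J m n : smx_horner 0 J m n = 0.
Proof. by rewrite /smx_horner size_poly0 big_ord0. Qed.

Lemma smx_horner1 J : smx_horner 1 J = smx_one C.
Proof.
by apply/funext => m; apply/funext => n; rewrite /smx_horner size_poly1 big_ord1
  coef1 mul1r.
Qed.

End Horner.

(** * Jacobi matrices *)

Lemma fsum_ord (C : nmodType) N (F : nat -> C) :
  (forall k, (N <= k)%N -> F k = 0) ->
  \sum_(k \in [set: nat]) F k = \sum_(k < N) F k.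
Proof.
move=> F0; rewrite (fsbig_ord _ N F); apply/esym/fsbig_widen => // k [_ /= /negP].
by rewrite -leqNgt => /F0.
Qed.

Section JacobiMatrix.
Variable R : realType.
Variables a b : nat -> R.
Hypothesis a_neq0 : forall n, a n != 0.

Local Notation J := (jacobi a b).
Local Notation al := (fun n => (a n)%:C).
Local Notation be := (fun n => (b n)%:C).
Local Notation P := (ortho_poly a b).
Local Notation Q k := (smx_horner (ortho_poly a b k) (jacobi a b)).
Implicit Types X A : smatrix R[i].

Lemma jacobi_sym m n : J m n = J n m.
Proof.
rewrite /jacobi eq_sym; case: eqVneq => [->//|_].
case: eqVneq => [->|_]; last by case: eqVneq.
by rewrite ltn_eqF // ltnS ltnW.
Qed.

Lemma jacobi_mull X m n : smx_mul J X m n = three_term al be (X^~ n) m.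
Proof.
have J0 i j : (i.+2 <= j)%N -> J i j = 0.
  move=> lt_ij; have lt_ij' := ltnW lt_ij.
  by rewrite /jacobi (ltn_eqF lt_ij') (gtn_eqF lt_ij) (ltn_eqF (leqW lt_ij')).
rewrite /smx_mul (fsum_ord (N := m.+2)) => [|k lt_mk]; last by rewrite J0 ?mul0r.
have Jd i : J i i = be i by rewrite /jacobi eqxx.
have Ju i : J i i.+1 = al i by rewrite /jacobi eqxx ltn_eqF.
rewrite !big_ord_recr /= Jd Ju /three_term; congr (_ + _ + _).
case: m => [|m]; first by rewrite big_ord0.
rewrite big_ord_recr /= jacobi_sym Ju big1 ?add0r // => i _.
by rewrite jacobi_sym J0 ?mul0r // !ltnS.
Qed.

Lemma jacobi_mulr X m n : smx_mul X J m n = three_term al be (X m) n.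
Proof.
rewrite -(jacobi_mull (smx_tr X)).
by apply: eq_fsbigr => k _; rewrite mulrC jacobi_sym.
Qed.

Lemma jacobi_commP A : smx_mul J A = smx_mul A J <-> commuting al be A.
Proof.
split=> [cA m n|cA]; first by rewrite -jacobi_mull cA jacobi_mulr.
by apply/funext => m; apply/funext => n; rewrite jacobi_mull cA -jacobi_mulr.
Qed.

Lemma smx_expS i : smx_exp J i.+1 =
  fun m n => three_term al be ((smx_exp J i)^~ n) m.
Proof. by apply/funext => m; apply/funext => n; rewrite -jacobi_mull. Qed.

Lemma commuting_exp i : commuting al be (smx_exp J i).
Proof.
elim: i => [|i IHi]; first exact: commuting_one.
by rewrite smx_expS; apply: commuting_three_term.
Qed.

(** Transposing J^(i+1) = J J^i gives J^i J, which is J J^i again. *)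
Lemma smx_exp_sym i m n : smx_exp J i m n = smx_exp J i n m.
Proof.
elim: i m n => [|i IHi] m n; first exact: smx_one_sym.
by rewrite smx_expS commuting_exp; apply: eq_three_term => k _.
Qed.

Lemma commuting_horner p : commuting al be (smx_horner p J).
Proof. by apply: commuting_sum => i; apply: commuting_exp. Qed.

Lemma smx_horner_sym p m n : smx_horner p J m n = smx_horner p J n m.
Proof. by apply: eq_bigr => i _; rewrite smx_exp_sym. Qed.

Lemma smx_hornerXM p m n :
  smx_horner ('X * p) J m n = three_term al be ((smx_horner p J)^~ n) m.
Proof.
rewrite three_term_sum (@smx_horner_widen _ (size p).+1); last first.
  by apply: leq_trans (size_polyMleq _ _) _; rewrite size_polyX.
rewrite big_ord_recl coefXM mul0r add0r; apply: eq_bigr => i _.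
by rewrite coefXM smx_expS.
Qed.

(** The sequence of the P_n is an eigenvector of J with eigenvalue 'X: this is
    the recurrence, with its initial case included. *)
Lemma ortho_polyXM n : 'X * P n =
  (if n is n'.+1 then al n' *: P n' else 0) + be n *: P n + al n *: P n.+1.
Proof.
case: n => [|n]; apply/eqP; rewrite eq_sym -subr_eq0 -!mul_polyC; apply/eqP.
  by rewrite -[RHS](ortho_poly_rec0 b (a_neq0 0)) -!mul_polyC; ring.
by rewrite -[RHS](ortho_poly_recS b (a_neq0 n.+1)) -!mul_polyC; ring.
Qed.

(** With k and j as row and column indices, the entries Q k 0 j form an array D
    that commutes with J: the row action on D is the entry (0, j) of
    Q k J = J Q k = ('X P_k)(J), which the recurrence expands into the column
    action.  Locality then compares D with the identity matrix. *)
Lemma horner_ortho_row0 k j : Q k 0%N j = smx_one _ k j.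
Proof.
pose D : smatrix R[i] := fun k j => Q k 0%N j.
rewrite -/(D k j); apply: (@commuting_local _ al be).
- by move=> n; rewrite (inj_eq (@complexI R)).
- move=> n i; rewrite -[RHS](commuting_horner (P n)) -smx_hornerXM ortho_polyXM.
  rewrite !smx_hornerD !smx_hornerZ /three_term.
  by case: n => [|n]; [rewrite smx_horner0 | rewrite smx_hornerZ].
- exact: commuting_one.
- by move=> i _; rewrite /D ortho_poly0 smx_horner1.
Qed.

Lemma horner_ortho_eq0 k m n : (m + n < k)%N -> Q k m n = 0.
Proof.
move=> lt_mn_k; apply: (@commuting_local _ al be _ _ (fun _ _ => 0)).
- by move=> i; rewrite (inj_eq (@complexI R)).
- exact: commuting_horner.
- by move=> i j; rewrite /three_term; case: i j => [|i] [|j];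
    rewrite !mulr0 !addr0.
- move=> j le_j; rewrite horner_ortho_row0 /smx_one gtn_eqF //.
  exact: leq_ltn_trans lt_mn_k.
Qed.

Definition partial_sum (alpha : nat -> R[i]) N : smatrix R[i] :=
  fun m n => \sum_(k < N) alpha k * Q k m n.

Lemma commuting_partial_sum alpha N : commuting al be (partial_sum alpha N).
Proof. by apply: commuting_sum => i; apply: commuting_horner. Qed.

Lemma partial_sum_row0 alpha N j : (j < N)%N ->
  partial_sum alpha N 0%N j = alpha j.
Proof.
move=> lt_jN; rewrite /partial_sum (bigD1 (Ordinal lt_jN)) //= big1 => [|k ne_k].
  by rewrite horner_ortho_row0 /smx_one eqxx mulr1 addr0.
by rewrite horner_ortho_row0 /smx_one (negPf (_ : k != j :> nat)) ?mulr0.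
Qed.

(** Since Q k m n = 0 for k > m + n, the series is locally finite, and each of its
    entries is reached by every sufficiently long partial sum. *)
Lemma ortho_is_sumP alpha A :
  smx_is_sum (fun k => smx_scale (alpha k) (Q k)) A <->
  forall m n N, (m + n < N)%N -> A m n = partial_sum alpha N m n.
Proof.
have sumE m n N : (m + n < N)%N ->
    \sum_(k \in [set: nat]) smx_scale (alpha k) (Q k) m n =
    partial_sum alpha N m n.
  move=> lt_N; apply: fsum_ord => k le_Nk.
  by rewrite /smx_scale horner_ortho_eq0 ?mulr0 // (leq_trans lt_N).
split=> [sA m n N lt_N|sA m n]; first by rewrite (sA m n).2 (sumE _ _ N).
split; last by rewrite (sumE _ _ (m + n).+1) // -sA.
apply: sub_finite_set (finite_II (m + n).+1) => k /=; apply: contra_neqT.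
by rewrite -leqNgt => le_k; rewrite /smx_scale horner_ortho_eq0 ?mulr0.
Qed.

Lemma commuting_eq_partial_sum A m n N : commuting al be A -> (m + n < N)%N ->
  A m n = partial_sum (A 0%N) N m n.
Proof.
move=> cA lt_N; apply: (@commuting_local _ al be) => //.
- by move=> i; rewrite (inj_eq (@complexI R)).
- exact: commuting_partial_sum.
- by move=> j le_j; rewrite partial_sum_row0 // (leq_ltn_trans le_j).
Qed.

(** No infinite sum has to be exchanged with a product by J: the relation at
    (m, n) involves only entries whose indices add up to at most m + n + 1, and
    there a single partial sum represents A. *)
Lemma partial_sum_commuting alpha A :
  (forall m n N, (m + n < N)%N -> A m n = partial_sum alpha N m n) ->
  commuting al be A.
Proof.
move=> sA m n; pose N := (m + n).+2.
rewrite (@eq_three_term _ _ _ _ ((partial_sum alpha N)^~ n)) => [|k le_k]; last first.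
  by apply: sA; rewrite ltnS -addSn leq_add2r.
rewrite commuting_partial_sum; apply: eq_three_term => k le_k.
by apply/esym/sA; rewrite ltnS -addnS leq_add2l.
Qed.

Lemma commuting_sym A : commuting al be A -> A = smx_tr A.
Proof.
move=> cA; apply/funext => m; apply/funext => n; rewrite /smx_tr.
have lt_nm : (n + m < (m + n).+1)%N by rewrite addnC.
rewrite (commuting_eq_partial_sum cA (ltnSn _)).
rewrite (commuting_eq_partial_sum cA lt_nm).
by apply: eq_bigr => k _; rewrite smx_horner_sym.
Qed.

End JacobiMatrix.

Theorem theorem11 (R : realType) (a b : nat -> R) (ha : forall n, a n != 0)
    (A : smatrix R[i]) :
  let J := jacobi a b in
  (smx_mul J A = smx_mul A J <->
   exists alpha : nat -> R[i],
     smx_is_sum (fun k => smx_scale (alpha k) (smx_horner (ortho_poly a b k) J)) A)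
  /\ (smx_mul J A = smx_mul A J -> A = smx_tr A).
Proof.
move=> J; split=> [|/jacobi_commP]; last exact: commuting_sym.
split=> [/jacobi_commP cA|[alpha /(ortho_is_sumP b ha) sA]]; last first.
  by apply/jacobi_commP/(partial_sum_commuting sA).
exists (A 0%N); apply/(ortho_is_sumP b ha) => m n N.
exact: commuting_eq_partial_sum.
Qed.
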